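(* Let $q$ be a prime power, let $m\le n$ and $\epsilon$ be positive integers with $m>2\epsilon$, and let $\mathbf{A}\in\mathbb{F}_q^{m\times n}$ with $\mathrm{rank}(\mathbf{A})=m$. Let $\mathscr{C}_A\subseteq\mathbb{F}_q^n$ be the linear code spanned by the rows of $\mathbf{A}$ and $\mathscr{C}_A^{\perp}=\{\mathbf{y}\in\mathbb{F}_q^n\;|\;\mathbf{A}\mathbf{y}=\mathbf{0}\}$ its dual code. Let $l_{q,\mathrm{opt}}$ be the optimal linear codelength of the $(\mathbf{A},\epsilon)$ function update problem over $\mathbb{F}_q$. Then $l_{q,\mathrm{opt}}=m$ if and only if $r_{\mathrm{cov}}(\mathscr{C}_A^{\perp})\le 2\epsilon$.
   Context: Vectors are column vectors and $\mathrm{wt}$ denotes Hamming weight. For the $(\mathbf{A},\epsilon)$ function update problem over $\mathbb{F}_q$, a matrix $\mathbf{H}\in\mathbb{F}_q^{l\times n}$ is called a valid encoder matrix of codelength $l$ if there exists a function $\mathfrak{D}:\mathbb{F}_q^l\times\mathbb{F}_q^m\to\mathbb{F}_q^m$ such that $\mathfrak{D}(\mathbf{H}(\mathbf{x}+\mathbf{e}),\mathbf{A}\mathbf{x})=\mathbf{A}(\mathbf{x}+\mathbf{e})$ for all $\mathbf{x},\mathbf{e}\in\mathbb{F}_q^n$ with $\mathrm{wt}(\mathbf{e})\le\epsilon$. The optimal linear codelength $l_{q,\mathrm{opt}}$ is the minimum $l$ for which a valid encoder matrix $\mathbf{H}\in\mathbb{F}_q^{l\times n}$ exists. The covering radius $r_{\mathrm{cov}}(\mathscr{C})$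 of a linear code $\mathscr{C}\subseteq\mathbb{F}_q^n$ is the smallest integer $r$ such that the Hamming spheres (balls) of radius $r$ centered at the codewords of $\mathscr{C}$ cover $\mathbb{F}_q^n$. *)

(* Defs.v *)
From HB Require Import structures.
From mathcomp Require Import all_boot all_order all_algebra.

Set Implicit Arguments.
Unset Strict Implicit.
Unset Printing Implicit Defensive.

Import GRing.Theory.
Local Open Scope ring_scope.

Definition wt (F : finFieldType) (n : nat) (v : 'cV[F]_n) : nat :=
  #|[set i | v i 0 != 0]|.

Lemma wt_le (F : finFieldType) (n : nat) (v : 'cV[F]_n) : (wt v <= n)%N.
Proof. by rewrite -[leqRHS]card_ord max_card. Qed.

(* The decoder is applied to the pair (H (x + e), A x). All types are finite,
   so quantifying over finite functions is quantifying over all functions. *)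
Definition valid_encoder (F : finFieldType) (m n : nat) (A : 'M[F]_(m, n))
    (eps l : nat) (H : 'M[F]_(l, n)) : bool :=
  [exists D : {ffun 'cV[F]_l * 'cV[F]_m -> 'cV[F]_m},
    [forall x : 'cV[F]_n, [forall e : 'cV[F]_n,
      (wt e <= eps)%N ==> (D (H *m (x + e), A *m x) == A *m (x + e))]]].

Lemma valid_encoderP (F : finFieldType) (m n : nat) (A : 'M[F]_(m, n))
    (eps l : nat) (H : 'M[F]_(l, n)) :
  reflect (exists D : 'cV[F]_l -> 'cV[F]_m -> 'cV[F]_m,
             forall x e : 'cV[F]_n, (wt e <= eps)%N ->
               D (H *m (x + e)) (A *m x) = A *m (x + e))
          (valid_encoder A eps H).
Proof.
apply: (iffP existsP) => [[D /forallP HD]|[D HD]].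
  exists (fun u v => D (u, v)) => x e we.
  by have /forallP/(_ e)/implyP/(_ we)/eqP := HD x.
exists [ffun p => D p.1 p.2]; apply/forallP => x; apply/forallP => e.
by apply/implyP => we; rewrite ffunE /= HD.
Qed.

Definition valid_codelength (F : finFieldType) (m n : nat) (A : 'M[F]_(m, n))
    (eps l : nat) : bool :=
  [exists H : 'M[F]_(l, n), valid_encoder A eps H].

Lemma valid_codelength_ex (F : finFieldType) (m n : nat) (A : 'M[F]_(m, n))
    (eps : nat) : exists l, valid_codelength A eps l.
Proof.
exists n; apply/existsP; exists 1%:M; apply/valid_encoderP.
by exists (fun u _ => A *m u) => x e _; rewrite mul1mx.
Qed.

Definition opt_codelength (F : finFieldType) (m n : nat) (A : 'M[F]_(m, n))
    (eps : nat) : nat :=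
  ex_minn (valid_codelength_ex A eps).

Definition hamming_ball (F : finFieldType) (n : nat) (c : 'cV[F]_n) (r : nat) :
    {set 'cV[F]_n} :=
  [set y | (wt (y - c) <= r)%N].

Definition balls_cover (F : finFieldType) (n : nat) (C : {vspace 'cV[F]_n})
    (r : nat) : bool :=
  \bigcup_(c in C) hamming_ball c r == [set: 'cV[F]_n].

Lemma balls_cover_ex (F : finFieldType) (n : nat) (C : {vspace 'cV[F]_n}) :
  exists r, balls_cover C r.
Proof.
exists n; apply/eqP/setP => y; rewrite inE.
by apply/bigcupP; exists 0; rewrite ?mem0v // inE wt_le.
Qed.

Definition covering_radius (F : finFieldType) (n : nat)
    (C : {vspace 'cV[F]_n}) : nat :=
  ex_minn (balls_cover_ex C).

(* Codewords are column vectors, so the rows of A are transposed. *)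
Definition row_code (F : finFieldType) (m n : nat) (A : 'M[F]_(m, n)) :
    {vspace 'cV[F]_n} :=
  <<[seq (row i A)^T | i : 'I_m]>>%VS.

(* The y with c^T y = 0 for every codeword c. *)
Definition dual_code (F : finFieldType) (n : nat) (C : {vspace 'cV[F]_n}) :
    {vspace 'cV[F]_n} :=
  (\bigcap_(c in C) lker (linfun (mulmx c^T : 'cV[F]_n -> 'cV[F]_1)))%VS.

Lemma mem_dual_code (F : finFieldType) (n : nat) (C : {vspace 'cV[F]_n})
    (y : 'cV[F]_n) :
  reflect (forall c : 'cV[F]_n, c \in C -> c^T *m y = 0) (y \in dual_code C).
Proof.
rewrite /dual_code memvE; apply: (iffP subv_bigcapP) => Hy c Cc.
  by have := Hy c Cc; rewrite -memvE memv_ker lfunE => /eqP.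
by rewrite -memvE memv_ker lfunE /= Hy.
Qed.

Lemma mem_dual_row_code (F : finFieldType) (m n : nat) (A : 'M[F]_(m, n))
    (y : 'cV[F]_n) :
  (y \in dual_code (row_code A)) = (A *m y == 0).
Proof.
apply/mem_dual_code/eqP => [Hy|Ay c].
  apply/row_matrixP => i; rewrite row_mul row0 -[row i A]trmxK Hy //.
  by apply: memv_span; apply: map_f; rewrite mem_enum.
set s := [seq (row i A)^T | i : 'I_m] => /(@coord_span _ _ _ (in_tuple s)) ->.
rewrite linear_sum mulmx_suml big1 // => i _.
rewrite linearZ -scalemxAl /=.
have /mapP[j _ ->] : (in_tuple s)`_i \in s by apply: mem_nth.
by rewrite trmxK -row_mul Ay row0 scaler0.
Qed.

(* Main.v *)
Require Import Defs.
From mathcomp Require Import all_boot all_order all_algebra.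

(** Write [S] for the set of syndromes [A w] with [wt w <= 2 eps]. Two
    executions of the protocol can be confused exactly when they differ by an
    element [z] of [ker H] with [A z] in [S], so [H] is valid iff
    [ker H] meets the preimage of [S] only inside [ker A]. Since [A] is onto,
    the covering radius of [ker A] is at most [2 eps] iff [S] is everything; in
    that case [ker H] is contained in [ker A] and [H] has rank at least [m].
    Otherwise pick [s] outside [S] and let [P] have [m - 1] rows and kernel
    [<s>]; as [S] is stable under scaling, [P A] is a valid encoder. *)

Set Implicit Arguments.
Unset Strict Implicit.
Unset Printing Implicit Defensive.

Import GRing.Theory.
Local Open Scope ring_scope.

Section HammingWeight.

Variables (F : finFieldType) (n : nat).
Implicit Types (u v w : 'cV[F]_n).

Lemma wt0 : wt (0 : 'cV[F]_n) = 0%N.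
Proof. by apply: eq_card0 => i; rewrite !inE mxE eqxx. Qed.

Lemma wtB u v : (wt (u - v) <= wt u + wt v)%N.
Proof.
apply: leq_trans (leq_card_setU _ _); apply/subset_leq_card/subsetP => i.
rewrite !inE !mxE; apply: contraR; rewrite negb_or !negbK => /andP[/eqP-> /eqP->].
by rewrite subr0.
Qed.

Lemma wtZ a v : (wt (a *: v) <= wt v)%N.
Proof.
apply/subset_leq_card/subsetP => i.
by rewrite !inE mxE mulf_eq0 negb_or => /andP[].
Qed.

(** Cut the support of [w] after its first [a] positions: [u] keeps the entries before the cut, and
    [u - w] lives on the rest. *)
Lemma wt_split a b w : (wt w <= a + b)%N ->
  exists u v, [/\ (wt u <= a)%N, (wt v <= b)%N & w = u - v].
Proof.
move=> w_ab; pose s := enum [set i | w i 0 != 0].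
pose u : 'cV[F]_n := \col_i if i \in take a s then w i 0 else 0.
have wt_seq v (t : seq 'I_n) : (forall i, v i 0 != 0 -> i \in t) ->
    (wt v <= size t)%N.
  move=> vt; apply: leq_trans (card_size t).
  by apply/subset_leq_card/subsetP => i; rewrite inE => /vt.
exists u, (u - w); split; last by rewrite opprB addrC subrK.
- apply: (@leq_trans (size (take a s))); last by rewrite size_take geq_minl.
  by apply: wt_seq => i; rewrite mxE; case: ifP => //; rewrite eqxx.
- apply: (@leq_trans (size (drop a s))).
    apply: wt_seq => i; rewrite !mxE; case: ifP => [_|ta]; first by rewrite subrr eqxx.
    rewrite sub0r oppr_eq0 => wi.
    have : i \in s by rewrite mem_enum inE.
    by rewrite -{1}(cat_take_drop a s) mem_cat ta.
  by rewrite size_drop leq_subLR -cardE.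
Qed.

End HammingWeight.

Lemma valid_encoder_kerP (F : finFieldType) (m n : nat) (A : 'M[F]_(m, n))
    (eps l : nat) (H : 'M[F]_(l, n)) :
  reflect (forall z w : 'cV[F]_n, (wt w <= 2 * eps)%N -> A *m z = A *m w ->
             H *m z = 0 -> A *m z = 0)
          (valid_encoder A eps H).
Proof.
apply: (iffP (valid_encoderP A eps H)) => [[D HD] z w|kerH].
  rewrite mul2n -addnn => /wt_split[e [e' [we we' ->]]] Az Hz.
  (* The executions [(z - e + e', e)] and [(0, e')] feed the decoder the same pair. *)
  have Dx := HD (z - e + e') e we; have D0 := HD 0 e' we'.
  have Ax : A *m (z - e + e') = A *m 0.
    by rewrite -addrA [_ + e']addrC -opprB mulmxBr Az subrr mulmx0.
  rewrite Ax addrAC subrK in Dx; rewrite add0r in D0.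
  rewrite [H *m (z + e')]mulmxDr Hz add0r in Dx.
  by apply: (addIr (A *m e')); rewrite add0r -mulmxDr -Dx -D0.
pose run (p : 'cV[F]_n * 'cV[F]_n) := (H *m (p.1 + p.2), A *m p.1).
(* Decode by any admissible execution that explains the input; the default [0] is never reached on
   genuine inputs. *)
exists (fun u v => if [pick p | (wt p.2 <= eps)%N && (run p == (u, v))] is Some p
  then A *m (p.1 + p.2) else 0) => x e we.
case: pickP => [[x' e'] /=|/(_ (x, e))]; last by rewrite we eqxx.
move=> /andP[we' /eqP[Hx Ax]]; apply/eqP; rewrite -subr_eq0 -mulmxBr; apply/eqP.
apply: (kerH _ (e' - e)); last by rewrite mulmxBr Hx subrr.
  by rewrite mul2n -addnn (leq_trans (wtB _ _)) // leq_add.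
by rewrite !mulmxBr !mulmxDr Ax opprD addrACA subrr add0r.
Qed.

Lemma covering_radius_leP (F : finFieldType) (n : nat) (C : {vspace 'cV[F]_n})
    (r : nat) :
  reflect (forall y, exists2 c, c \in C & (wt (y - c) <= r)%N)
          (covering_radius C <= r)%N.
Proof.
rewrite /covering_radius; case: ex_minnP => k cov_k min_k; apply: (iffP idP) => [kr y|cov].
  have : y \in \bigcup_(c in C) hamming_ball c k by rewrite (eqP cov_k) inE.
  by case/bigcupP => c Cc; rewrite inE => yk; exists c => //; apply: leq_trans kr.
apply/min_k/eqP/setP => y; rewrite [RHS]inE; have [c Cc yr] := cov y.
by apply/bigcupP; exists c; rewrite ?inE.
Qed.

(** Codewords [c] near [y] and light vectors [w] in the coset of [y] correspond by [c = y - w]. *)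
Lemma covering_radius_dual_row_codeP (F : finFieldType) (m n : nat)
    (A : 'M[F]_(m, n)) (r : nat) :
  reflect (forall y, exists2 w, (wt w <= r)%N & A *m y = A *m w)
          (covering_radius (dual_code (row_code A)) <= r)%N.
Proof.
apply: (iffP (covering_radius_leP _ _)) => cov y.
  have [c] := cov y; rewrite mem_dual_row_code => /eqP Ac wr.
  by exists (y - c); rewrite // mulmxBr Ac subr0.
have [w wr Ay] := cov y; exists (y - w).
  by rewrite mem_dual_row_code mulmxBr Ay subrr.
by rewrite opprB addrC subrK.
Qed.

(** The columns of [cokermx H] lie in the kernel of [H], so [A] kills them, which puts the row space
    of [A] inside that of [H]. *)
Lemma mxrank_ker_le (F : fieldType) (m l n : nat) (A : 'M[F]_(m, n))
    (H : 'M[F]_(l, n)) :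
  (forall z : 'cV_n, H *m z = 0 -> A *m z = 0) -> (\rank A <= \rank H)%N.
Proof.
move=> kerHA; apply: mxrankS; rewrite submxE; apply/eqP/matrixP => i j.
move: (cokermx H) (mulmx_coker H) => C HC0; have := kerHA (col j C).
rewrite colE !mulmxA HC0 mul0mx => /(_ erefl).
by rewrite -colE => /colP/(_ i); rewrite !mxE.
Qed.

Lemma line_kernel (F : fieldType) (m : nat) (s : 'cV[F]_m) : s != 0 ->
  exists P : 'M[F]_(m.-1, m), forall v : 'cV_m, P *m v = 0 -> exists a, v = a *: s.
Proof.
case/cV0Pn => i si; exists (row' i (1%:M - (s i 0)^-1 *: (s *m delta_mx 0 i))) => v Pv.
exists (v i 0 / s i 0); apply/colP => k; rewrite mxE.
case: (unliftP i k) => [j|] ->; last by rewrite divfK.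
move/colP/(_ j)/eqP: Pv; rewrite row'Esub mul_rowsub_mx mulmxBl mul1mx.
rewrite -scalemxAl -mulmxA -rowE !mxE big_ord1 !mxE subr_eq0 => /eqP->.
by rewrite [s _ _ * v _ _]mulrC mulrCA mulrA.
Qed.

Lemma opt_codelength_le (F : finFieldType) (m n : nat) (A : 'M[F]_(m, n))
    (eps l : nat) (H : 'M[F]_(l, n)) :
  valid_encoder A eps H -> (opt_codelength A eps <= l)%N.
Proof.
move=> validH; rewrite /opt_codelength; case: ex_minnP => k _; apply.
by apply/existsP; exists H.
Qed.

Theorem corollary3 (F : finFieldType) (m n eps : nat) (A : 'M[F]_(m, n))
    (m_gt0 : (0 < m)%N) (le_mn : (m <= n)%N) (eps_gt0 : (0 < eps)%N)
    (lt_2eps_m : (2 * eps < m)%N) (rankA : \rank A = m) :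
  opt_codelength A eps = m <->
  (covering_radius (dual_code (row_code A)) <= 2 * eps)%N.
Proof.
split=> [opt_m|/covering_radius_dual_row_codeP cov].
  apply/covering_radius_dual_row_codeP => y.
  suff /exists_inP[w ww /eqP Ay] :
    [exists (w : 'cV[F]_n | (wt w <= 2 * eps)%N), A *m y == A *m w] by exists w.
  apply: contraLR (leqnn m) => /exists_inPn far; rewrite -ltnNge.
  (* The zero vector is light, so [far] applies to it. *)
  have Ay0 : A *m y != 0 by rewrite -(mulmx0 _ A) far // unfold_in wt0.
  have [P kerP] := line_kernel Ay0.
  suff: (opt_codelength A eps <= m.-1)%N by rewrite opt_m -ltnS prednK.
  apply: (@opt_codelength_le _ _ _ _ _ _ (P *m A)); apply/valid_encoder_kerP.
  move=> z w ww Az; rewrite -mulmxA => /kerP[a Aza].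
  have [a0|a_neq0] := eqVneq a 0; first by rewrite Aza a0 scale0r.
  (* Rescaling [w] would give a light vector with syndrome [A *m y]. *)
  have /negP[] := far (a^-1 *: w) (leq_trans (wtZ _ _) ww).
  by rewrite -scalemxAr -Az Aza scalerA mulVf // scale1r.
apply/eqP; rewrite eqn_leq; apply/andP; split.
  (* Sending [A *m (x + e)] itself always works. *)
  by apply: (@opt_codelength_le _ _ _ _ _ _ A); apply/valid_encoder_kerP.
rewrite /opt_codelength; case: ex_minnP => l /existsP[H /valid_encoder_kerP kerH] _.
rewrite -[leqLHS]rankA; apply: leq_trans (rank_leq_row H).
apply: mxrank_ker_le => z; have [w ww Az] := cov z; exact: kerH ww Az.
Qed.
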